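(* Let $m,n\ge1$, let $A_i,\widetilde A_i$ ($i=1,\dots,m$) be $n\times n$ complex matrices and let $Q,\widetilde Q$ be $n\times n$ Hermitian positive definite matrices. Let $X$ and $\widetilde X$ be the (unique) Hermitian positive definite solutions of $X-\sum_{i=1}^m A_i^*X^{-1}A_i=Q$ and $\widetilde X-\sum_{i=1}^m\widetilde A_i^*\widetilde X^{-1}\widetilde A_i=\widetilde Q$, respectively. Put $\Delta A_i=\widetilde A_i-A_i$, $\Delta Q=\widetilde Q-Q$, let $\beta$ be the positive number defined in the context, and set $$b=\beta^2+\beta\|\Delta Q\|-\sum_{i=1}^m\|A_i\|^2,\qquad s=\sum_{i=1}^m\|\Delta A_i\|\,(2\|A_i\|+\|\Delta A_i\|).$$ If $$0<b<2\beta^2\quad\text{and}\quad b^2-4\beta^2(\beta\|\Delta Q\|+s)\ge 0,$$ then $$\frac{\|\widetilde X-X\|}{\|X\|}\le \varrho\sum_{i=1}^m\|\Delta A_i\|+\omega\|\Delta Q\|,$$ where $$\varrho=\frac{2s}{\sum_{i=1}^m\|\Delta A_i\|\left(b+\sqrt{b^2-4\beta^2(\beta\|\Delta Q\|+s)}\right)},\qquad \omega=\frac{2\beta}{b+\sqrt{b^2-4\beta^2(\beta\|\Delta Q\|+s)}}$$ (if all $\Delta A_i=0$, the term $\varrho\sum_i\|\Delta A_i\|$ is read as $0$).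
   Context: $\|\cdot\|$ is the spectral norm, $A^*$ the conjugate transpose, and $\lambda_{\max}(M)$, $\lambda_{\min}(M)$ are the largest and smallest eigenvalues of a Hermitian matrix $M$. For every choice of $n\times n$ complex $A_i$ and Hermitian positive definite $Q$, the equation $X-\sum_{i=1}^m A_i^*X^{-1}A_i=Q$ has exactly one Hermitian positive definite solution. The number $\beta$ (depending on the unperturbed data $A_1,\dots,A_m,Q$) is the positive solution $x$ of $$x=\lambda_{\min}(Q)+\frac{\sum_{i=1}^m\lambda_{\min}(A_i^*A_i)}{\lambda_{\max}(Q)+\dfrac{\sum_{i=1}^m\lambda_{\max}(A_i^*A_i)}{x}}.$$ *)

(* Defs.v *)
From mathcomp Require Import all_boot all_order all_algebra.
From mathcomp Require Import classical_sets reals complex.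

Set Implicit Arguments.
Unset Strict Implicit.
Unset Printing Implicit Defensive.

Import Order.TTheory GRing.Theory Num.Theory.
Local Open Scope ring_scope.
Local Open Scope sesquilinear_scope.

(* In R[i], [0 < z] means that z is real and positive. *)
Definition hermitian_posdef (R : realType) (n : nat) (M : 'M[R[i]]_n) : Prop :=
  M \is hermsymmx /\
  forall v : 'cV[R[i]]_n, v != 0 -> 0 < (v^t* *m M *m v) 0 0.

(* Only meaningful for Hermitian M with 0 < n, where all the eigenvalues are
   real and the set of eigenvalues is finite and nonempty, so that sup and inf
   are its largest and smallest elements. *)
Definition real_eigenvalues (R : realType) (n : nat) (M : 'M[R[i]]_n) : set R :=
  [set a : R | eigenvalue M (a%:C)%C]%classic.

Definition lambda_max (R : realType) (n : nat) (M : 'M[R[i]]_n) : R :=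
  sup (real_eigenvalues M).

Definition lambda_min (R : realType) (n : nat) (M : 'M[R[i]]_n) : R :=
  inf (real_eigenvalues M).

(* The largest singular value of M; not to be confused with the entrywise
   maximum norm that MathComp-Analysis attaches to the notation `|M|. *)
Definition spectral_norm (R : realType) (n : nat) (M : 'M[R[i]]_n) : R :=
  Num.sqrt (lambda_max (M^t* *m M)).

(* X - \sum_i A_i^* X^-1 A_i = Q *)
Definition solves_equation (R : realType) (m n : nat)
    (A : 'I_m -> 'M[R[i]]_n) (Q X : 'M[R[i]]_n) : Prop :=
  X - \sum_(i < m) (A i)^t* *m invmx X *m A i = Q.

(* Main.v *)
Require Import Defs.
From mathcomp Require Import all_boot all_order all_algebra.
From mathcomp Require Import classical_sets reals complex.
From mathcomp Require Import ring lra.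

(** Put [F Z = Q' + \sum_i A'_i^* Z^-1 A'_i], so that [X' = F X'], and let [d]
    be the smaller root of [beta d^2 - b d + beta (beta |dQ| + s) = 0]. Since
    [beta <= X], a Hermitian [Z] with [|Z - X| <= d < beta] satisfies
    [beta - d <= Z]; expanding [F Z - X] then shows [|F Z - X| <= d], the bound
    being exactly the equation for [d]. Hence all iterates of [F] started at
    [X] stay within [d] of [X]. They converge to [X']: if [Z] lies between
    [X' / v] and [v X'], and [e X' <= Q'], then [F Z] lies between [X' / w] and
    [w X'] with [w - 1 = (1 - e) (v - 1)]. So [|X' - X| <= d], and
    [beta <= |X|] gives the relative bound. Vectors are rows, and C^n is
    treated as a real inner product space with [ip u v = Re (u v^* )]. *)

Set Implicit Arguments.
Unset Strict Implicit.
Unset Printing Implicit Defensive.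

Import Order.TTheory GRing.Theory Num.Theory.
Local Open Scope ring_scope.
Local Open Scope sesquilinear_scope.

(** * The real inner product on complex row vectors *)

Section RealInnerProduct.
Variables (R : realType) (n : nat).
Implicit Types (u v w : 'rV[R[i]]_n) (M : 'M[R[i]]_n) (r : R).

Definition ip u v : R := complex.Re ((u *m v^t*) 0 0).

Definition nm u : R := Num.sqrt (ip u u).

Lemma ReD (x y : R[i]) : complex.Re (x + y) = complex.Re x + complex.Re y.
Proof. by case: x y => [a b] [c d]. Qed.

Lemma ReMl (r : R) (x : R[i]) : complex.Re ((r%:C)%C * x) = r * complex.Re x.
Proof. by case: x => [a b] /=; rewrite mul0r subr0. Qed.

Lemma ipE u v : ip u v = \sum_i complex.Re (u 0 i * (v 0 i)^*).
Proof.
rewrite /ip mxE (big_morph _ ReD (erefl : complex.Re (0 : R[i]) = 0)).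
by apply: eq_bigr => i _; rewrite !mxE.
Qed.

Lemma Re_mulC_conj (x y : R[i]) :
  complex.Re (x * y^*) = complex.Re (y * x^*).
Proof. by case: x y => [a b] [c d] /=; ring. Qed.

Lemma ipC u v : ip u v = ip v u.
Proof. by rewrite !ipE; apply: eq_bigr => i _; exact: Re_mulC_conj. Qed.

Lemma ipDl u v w : ip (u + v) w = ip u w + ip v w.
Proof. by rewrite /ip mulmxDl mxE ReD. Qed.

Lemma ip0l u : ip 0 u = 0.
Proof. by rewrite /ip mul0mx mxE. Qed.

Lemma ipZl r u v : ip ((r%:C)%C *: u) v = r * ip u v.
Proof. by rewrite /ip -scalemxAl mxE ReMl. Qed.

Lemma ipNl u v : ip (- u) v = - ip u v.
Proof. by rewrite -mulN1r -ipZl rmorphN1 scaleN1r. Qed.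

Lemma ipDr u v w : ip u (v + w) = ip u v + ip u w.
Proof. by rewrite !(ipC u) ipDl. Qed.

Lemma ipZr r u v : ip u ((r%:C)%C *: v) = r * ip u v.
Proof. by rewrite !(ipC u) ipZl. Qed.

Lemma ipNr u v : ip u (- v) = - ip u v.
Proof. by rewrite !(ipC u) ipNl. Qed.

Lemma Re_sq_ge0 (x : R[i]) : 0 <= complex.Re (x * x^*).
Proof. by case: x => [a b] /=; nra. Qed.

Lemma ip_ge0 u : 0 <= ip u u.
Proof. by rewrite ipE; apply: sumr_ge0 => i _; exact: Re_sq_ge0. Qed.

Lemma ip_gt0 u : u != 0 -> 0 < ip u u.
Proof.
move=> u0; have : 0 < dotmx u u by exact: dotmx_is_dotmx.
by rewrite dotmxE ltcE => /andP[].
Qed.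

Lemma ip_adj u v M : ip (u *m M) v = ip u (v *m M^t*).
Proof. by rewrite /ip trmx_mul map_mxM trmxCK mulmxA. Qed.

Lemma nm_ge0 u : 0 <= nm u.
Proof. exact: sqrtr_ge0. Qed.

Lemma nm_sqr u : nm u ^+ 2 = ip u u.
Proof. by rewrite sqr_sqrtr // ip_ge0. Qed.

(** Cauchy-Schwarz: the squared length of [|v| u - |u| v] is [2 |u| |v| (|u| |v| - ip u v)], and the
    factor in front is positive once [u] and [v] are nonzero. *)
Lemma ip_le_nm u v : ip u v <= nm u * nm v.
Proof.
have [->|u0] := eqVneq u 0.
  by rewrite ip0l mulr_ge0 ?nm_ge0.
have [->|v0] := eqVneq v 0.
  by rewrite ipC ip0l mulr_ge0 ?nm_ge0.
have u_gt0 : 0 < nm u by rewrite sqrtr_gt0 ip_gt0.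
have v_gt0 : 0 < nm v by rewrite sqrtr_gt0 ip_gt0.
have := ip_ge0 (((nm v)%:C)%C *: u - ((nm u)%:C)%C *: v).
rewrite ipDl !ipDr !ipNl !ipNr !ipZl !ipZr -!nm_sqr (ipC v u) => h.
have {}h : 0 <= (nm u * nm v) * (nm u * nm v - ip u v) by nra.
by rewrite -subr_ge0 -(pmulr_rge0 _ (mulr_gt0 u_gt0 v_gt0)).
Qed.

Lemma nm_le r u v : 0 <= r -> ip u u <= r ^+ 2 * ip v v -> nm u <= r * nm v.
Proof.
move=> r0; rewrite -!nm_sqr -exprMn => h.
by rewrite -(@ler_pXn2r _ 2) // nnegrE ?mulr_ge0 ?nm_ge0.
Qed.

End RealInnerProduct.

(** * Quadratic forms, adjoints and the spectral theorem *)

Section QuadraticForm.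
Variables (R : realType) (n : nat).
Implicit Types (u v : 'rV[R[i]]_n) (M N H : 'M[R[i]]_n) (c : R).

Definition qf M u : R := ip (u *m M) u.

Lemma qfD M N u : qf (M + N) u = qf M u + qf N u.
Proof. by rewrite /qf mulmxDr ipDl. Qed.

Lemma qfN M u : qf (- M) u = - qf M u.
Proof. by rewrite /qf mulmxN ipNl. Qed.

Lemma qf_sum I (r : seq I) (F : I -> 'M[R[i]]_n) u :
  qf (\sum_(i <- r) F i) u = \sum_(i <- r) qf (F i) u.
Proof.
apply: (big_morph (fun M => qf M u)) => [M N|]; first exact: qfD.
by rewrite /qf mulmx0 ip0l.
Qed.

Lemma qf_conj M N u : qf (M^t* *m N *m M) u = qf N (u *m M^t*).
Proof. by rewrite /qf !mulmxA ip_adj. Qed.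

Lemma qf_gram M u : qf (M^t* *m M) u = ip (u *m M^t*) (u *m M^t*).
Proof. by rewrite /qf !mulmxA ip_adj. Qed.

Lemma trmxCM M N : (M *m N)^t* = N^t* *m M^t*.
Proof. by rewrite trmx_mul map_mxM. Qed.

Lemma trmxCD M N : (M + N)^t* = M^t* + N^t*.
Proof. by rewrite linearD /= map_mxD. Qed.

Lemma trmxCN M : (- M)^t* = - M^t*.
Proof. by rewrite linearN /= map_mxN. Qed.

Lemma trmxC_sum I (r : seq I) (F : I -> 'M[R[i]]_n) :
  (\sum_(i <- r) F i)^t* = \sum_(i <- r) (F i)^t*.
Proof.
elim/big_rec2: _ => [|i M N _ <-]; first by rewrite trmx0 map_mx0.
exact: trmxCD.
Qed.

Lemma trmxC_inv M : (invmx M)^t* = invmx (M^t*).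
Proof. by rewrite trmx_inv map_invmx. Qed.

Lemma gram_herm M : (M^t* *m M)^t* = M^t* *m M.
Proof. by rewrite trmxCM trmxCK. Qed.

Lemma hermsymmxE H : H \is hermsymmx = (H^t* == H).
Proof. by rewrite qualifE /= expr0 scale1r eq_sym. Qed.

(** The weight [w u i] is the squared modulus of the [i]-th coordinate of [u] in an orthonormal
    eigenbasis. Later bounds then reduce to comparing sums over the eigenvalues term by term, and
    the unitary matrix stays hidden. *)
Lemma herm_spectral H : H^t* = H ->
  exists (d : 'I_n -> R) (w : 'rV[R[i]]_n -> 'I_n -> R),
  [/\ forall u i, 0 <= w u i, forall u, ip u u = \sum_i w u i,
      forall u, qf H u = \sum_i d i * w u i,
      forall u, ip (u *m H) (u *m H) = \sum_i d i ^+ 2 * w u i &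
      forall i, eigenvalue H ((d i)%:C)%C].
Proof.
move=> /eqP; rewrite -hermsymmxE => Hh.
have := hermitian_spectral_diag_real Hh.
have /hermitian_normalmx/orthomx_spectralP := Hh.
have := spectral_unitarymx H; move: (spectralmx H) (spectral_diag H) => P D.
move=> Pu; rewrite invmx_unitary // => HE /mxOverP Dr.
pose d i := complex.Re (D 0 i).
have dE i : D 0 i = ((d i)%:C)%C by rewrite /d RRe_real.
have ipP u v : ip (u *m P^t*) (v *m P^t*) = ip u v.
  by rewrite -[v *m _ in LHS]/(v *m P^t*) -ip_adj mulmxKtV.
have ipP' u v : ip (u *m P) (v *m P) = ip u v.
  by rewrite ip_adj mulmxtVK.
have yD (y : 'rV_n) i : (y *m diag_mx D) 0 i = y 0 i * ((d i)%:C)%C.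
  by rewrite mul_mx_diag mxE dE.
exists d, (fun u i => complex.Re ((u *m P^t*) 0 i * ((u *m P^t*) 0 i)^*)).
split.
- by move=> u i; exact: Re_sq_ge0.
- by move=> u; rewrite -ipP ipE.
- move=> u; rewrite /qf {1}HE !mulmxA ip_adj ipE; apply: eq_bigr => i _.
  by rewrite yD -ReMl; congr complex.Re; ring.
- move=> u; rewrite {1 2}HE !mulmxA ipP' ipE; apply: eq_bigr => i _.
  rewrite yD -ReMl rmorphXn rmorphM /=; congr complex.Re.
  have -> : (((d i)%:C)%C)^* = ((d i)%:C)%C by rewrite [LHS]conjc_real.
  by ring.
(* Row [i] of [P] is an eigenvector for [d i]; it is nonzero because [P P^*] has the diagonal entry
   1. *)
- move=> i; apply/eigenvalueP; exists (row i P).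
    rewrite -row_mul HE !mulmxA (unitarymxP Pu) mul1mx mul_diag_mx.
    by apply/rowP => j; rewrite !mxE dE.
  apply: contraTneq isT => /(congr1 (fun v => (v *m P^t*) 0 i)).
  rewrite -row_mul (unitarymxP Pu) mul0mx !mxE eqxx => /eqP.
  by rewrite oner_eq0.
Qed.

End QuadraticForm.

(** * Extreme eigenvalues and the spectral norm *)

Section SpectralNorm.
Variables (R : realType) (n : nat).
Hypothesis n_gt0 : (0 < n)%N.
Implicit Types (u v : 'rV[R[i]]_n) (M N H : 'M[R[i]]_n) (c : R).

Lemma eigenvalue_qf M (a : R) : eigenvalue M (a%:C)%C ->
  exists2 v, v != 0 & qf M v = a * ip v v.
Proof. by case/eigenvalueP => v vE v0; exists v; rewrite // /qf vE ipZl. Qed.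

Lemma exists_real_eigenvalue H :
  H^t* = H -> (real_eigenvalues H !=set0)%classic.
Proof.
case/herm_spectral => d [w [_ _ _ _ ev]].
by exists (d (Ordinal n_gt0)); exact: ev.
Qed.

Lemma real_eigenvalue_le M c (a : R) : (forall u, qf M u <= c * ip u u) ->
  real_eigenvalues M a -> a <= c.
Proof.
move=> Mc /eigenvalue_qf [v v0 vE].
by have := Mc v; rewrite vE ler_pM2r // ip_gt0.
Qed.

Lemma real_eigenvalue_ge M c (a : R) : (forall u, c * ip u u <= qf M u) ->
  real_eigenvalues M a -> c <= a.
Proof.
move=> Mc /eigenvalue_qf [v v0 vE].
by have := Mc v; rewrite vE ler_pM2r // ip_gt0.
Qed.

Lemma lambda_max_le H c : H^t* = H -> (forall u, qf H u <= c * ip u u) ->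
  lambda_max H <= c.
Proof.
move=> Hh Hc; apply: ge_sup; first exact: exists_real_eigenvalue.
by move=> a; exact: real_eigenvalue_le.
Qed.

Lemma lambda_min_ge H c : H^t* = H -> (forall u, c * ip u u <= qf H u) ->
  c <= lambda_min H.
Proof.
move=> Hh Hc; apply: lb_le_inf; first exact: exists_real_eigenvalue.
by move=> a; exact: real_eigenvalue_ge.
Qed.

Lemma qf_le_lambda_max H u : H^t* = H -> qf H u <= lambda_max H * ip u u.
Proof.
move=> Hh; have [d [w [w0 wE qE _ ev]]] := herm_spectral Hh.
have d_le i : d i <= lambda_max H.
  (* An element is below [sup] only if the set is bounded above; the sum of all [|d j|] serves as a
     crude bound. *)
  apply: ub_le_sup (ev i); exists (\sum_j `|d j|) => a.
  apply: real_eigenvalue_le => v; rewrite wE qE mulr_sumr.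
  apply: ler_sum => j _; apply: ler_wpM2r => //.
  by apply: le_trans (ler_norm _) _; rewrite (bigD1 j) //= lerDl sumr_ge0.
by rewrite qE wE mulr_sumr; apply: ler_sum => i _; apply: ler_wpM2r.
Qed.

Lemma lambda_min_le_qf H u : H^t* = H -> lambda_min H * ip u u <= qf H u.
Proof.
move=> Hh; have [d [w [w0 wE qE _ ev]]] := herm_spectral Hh.
have le_d i : lambda_min H <= d i.
  apply: ge_inf (ev i); exists (- \sum_j `|d j|) => a.
  apply: real_eigenvalue_ge => v; rewrite wE qE mulr_sumr.
  apply: ler_sum => j _; apply: ler_wpM2r => //.
  rewrite lerNl; apply: le_trans (ler_norm _) _.
  by rewrite normrN (bigD1 j) //= lerDl sumr_ge0.
by rewrite qE wE mulr_sumr; apply: ler_sum => i _; apply: ler_wpM2r.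
Qed.

Lemma lambda_min_gram_ge0 M : 0 <= lambda_min (M^t* *m M).
Proof.
apply: lambda_min_ge => [|u]; first exact: gram_herm.
by rewrite mul0r qf_gram ip_ge0.
Qed.

Lemma lambda_min_le_max H : H^t* = H -> lambda_min H <= lambda_max H.
Proof.
move=> Hh; have [a Ha] := exists_real_eigenvalue Hh.
have [v v0 _] := eigenvalue_qf Ha.
rewrite -(ler_pM2r (ip_gt0 v0)).
exact: le_trans (lambda_min_le_qf _ Hh) (qf_le_lambda_max _ Hh).
Qed.

Lemma spectral_norm_ge0 M : 0 <= spectral_norm M.
Proof. exact: sqrtr_ge0. Qed.

Lemma spectral_norm_sqr M : spectral_norm M ^+ 2 = lambda_max (M^t* *m M).
Proof.
rewrite sqr_sqrtr // (le_trans (lambda_min_gram_ge0 M)) //.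
exact/lambda_min_le_max/gram_herm.
Qed.

(** Cauchy-Schwarz for [u] and [v M^*], followed by the Rayleigh bound for [M^* M] at [v]. *)
Lemma form_le_spectral_norm M u v :
  ip (u *m M) v <= spectral_norm M * (nm u * nm v).
Proof.
rewrite ip_adj mulrCA; apply: le_trans (ip_le_nm _ _) _.
apply: ler_wpM2l; first exact: nm_ge0.
apply: nm_le; first exact: spectral_norm_ge0.
by rewrite spectral_norm_sqr -qf_gram; apply/qf_le_lambda_max/gram_herm.
Qed.

Lemma nm_le_spectral_norm M u : nm (u *m M) <= spectral_norm M * nm u.
Proof.
have := form_le_spectral_norm M u (u *m M).
rewrite -nm_sqr expr2 mulrA; have [<-|h] := eqVneq 0 (nm (u *m M)).
  by rewrite mulr_ge0 ?nm_ge0 ?spectral_norm_ge0.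
by rewrite ler_pM2r // lt_neqAle h nm_ge0.
Qed.

(** Converse of [form_le_spectral_norm]: the norm is the least bound of the form. Testing the
    hypothesis at [u M^*] and [u] gives [|u M^*| <= c |u|], which bounds the eigenvalues of [M^* M]
    by [c^2]. *)
Lemma spectral_norm_le M c : 0 <= c ->
  (forall u v, ip (u *m M) v <= c * (nm u * nm v)) -> spectral_norm M <= c.
Proof.
move=> c0 Mc; rewrite -(@ler_pXn2r _ 2) ?nnegrE ?spectral_norm_ge0 //.
rewrite spectral_norm_sqr; apply: lambda_max_le => [|u]; first exact: gram_herm.
rewrite qf_gram -!nm_sqr -exprMn ler_pXn2r ?nnegrE ?mulr_ge0 ?nm_ge0 //.
have := Mc (u *m M^t*) u; rewrite ip_adj -nm_sqr expr2.
have [<-|h] := eqVneq 0 (nm (u *m M^t*)); first by rewrite mulr_ge0 ?nm_ge0.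
by rewrite mulrCA ler_pM2l // lt_neqAle h nm_ge0.
Qed.

Lemma spectral_norm_nm_le M c : 0 <= c ->
  (forall u, nm (u *m M) <= c * nm u) -> spectral_norm M <= c.
Proof.
move=> c0 Mc; apply: spectral_norm_le => // u v.
apply: le_trans (ip_le_nm _ _) _; rewrite mulrA.
by apply: ler_wpM2r; [exact: nm_ge0 | exact: Mc].
Qed.

Lemma spectral_normD M N :
  spectral_norm (M + N) <= spectral_norm M + spectral_norm N.
Proof.
apply: spectral_norm_le => [|u v]; first by rewrite addr_ge0 ?spectral_norm_ge0.
by rewrite mulmxDr ipDl mulrDl lerD // form_le_spectral_norm.
Qed.

Lemma spectral_norm_sum I (r : seq I) (F : I -> 'M[R[i]]_n) :
  spectral_norm (\sum_(i <- r) F i) <= \sum_(i <- r) spectral_norm (F i).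
Proof.
elim/big_rec2: _ => [|i c M _ IH].
  by apply: spectral_norm_le => // u v; rewrite mulmx0 ip0l mul0r.
exact: le_trans (spectral_normD _ _) (lerD (lexx _) IH).
Qed.

Lemma spectral_normN M : spectral_norm (- M) = spectral_norm M.
Proof. by rewrite /spectral_norm trmxCN mulNmx mulmxN opprK. Qed.

Lemma spectral_normM M N :
  spectral_norm (M *m N) <= spectral_norm M * spectral_norm N.
Proof.
apply: spectral_norm_nm_le => [|u].
  by rewrite mulr_ge0 ?spectral_norm_ge0.
rewrite mulmxA; apply: le_trans (nm_le_spectral_norm _ _) _.
have := ler_wpM2l (spectral_norm_ge0 N) (nm_le_spectral_norm M u).
move: (spectral_norm M) (spectral_norm N) (nm _) (nm u) => a b x y h.
by rewrite (mulrC a) -mulrA.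
Qed.

Lemma spectral_norm_adj M : spectral_norm (M^t*) = spectral_norm M.
Proof.
have le (K : 'M[R[i]]_n) : spectral_norm (K^t*) <= spectral_norm K.
  apply: spectral_norm_le => [|u v]; first exact: spectral_norm_ge0.
  by rewrite ip_adj trmxCK ipC (mulrC (nm u)) form_le_spectral_norm.
apply/eqP; rewrite eq_le; apply/andP; split; first exact: le.
by have := le (M^t*); rewrite trmxCK.
Qed.

Lemma qf_le_spectral_norm M u : qf M u <= spectral_norm M * ip u u.
Proof. by rewrite -nm_sqr form_le_spectral_norm. Qed.

Lemma qf_ge_spectral_norm M u : - (spectral_norm M * ip u u) <= qf M u.
Proof. by rewrite -spectral_normN lerNl -qfN qf_le_spectral_norm. Qed.

(** Both bounds together put every eigenvalue in [[-c, c]], so the squared eigenvalues that give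
    [|u H|^2] are at most [c^2]. *)
Lemma spectral_norm_herm_le H c : H^t* = H -> 0 <= c ->
  (forall u, qf H u <= c * ip u u) -> (forall u, - (c * ip u u) <= qf H u) ->
  spectral_norm H <= c.
Proof.
move=> Hh c0 leH geH; have [d [w [w0 wE _ NE ev]]] := herm_spectral Hh.
apply: spectral_norm_nm_le => // u; apply: nm_le => //.
rewrite NE wE mulr_sumr; apply: ler_sum => i _; apply: ler_wpM2r => //.
have := real_eigenvalue_le leH (ev i).
have geH' v : - c * ip v v <= qf H v by rewrite mulNr.
have := real_eigenvalue_ge geH' (ev i).
by move=> ? ?; nra.
Qed.

End SpectralNorm.

(** * Uniformly positive matrices and their inverses *)

Section Coercive.
Variables (R : realType) (n : nat).
Hypothesis n_gt0 : (0 < n)%N.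
Implicit Types (u v : 'rV[R[i]]_n) (M N H X Y Z : 'M[R[i]]_n) (c r : R).

(** Positive definiteness in quantitative form: the estimates need a uniform lower bound, not only
    positivity at each vector. *)
Definition coercive H : Prop :=
  H^t* = H /\ exists2 c : R, 0 < c & forall u, c * ip u u <= qf H u.

(** All eigenvalues [d i] are positive, and the inverse of [1 + \sum_i (d i)^-1] is a positive
    number below each of them, which replaces a minimum. *)
Lemma posdef_coercive H : hermitian_posdef H -> coercive H.
Proof.
move=> [Hs Hpos]; have Hh : H^t* = H by apply/eqP; rewrite -hermsymmxE.
split=> //; have [d [w [w0 wE qE _ ev]]] := herm_spectral Hh.
have d0 i : 0 < d i.
  have [v v0 vE] := eigenvalue_qf (ev i).
  (* [hermitian_posdef] tests columns, whereas the eigenvector [v] is a row. *)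
  have v0' : v^t* != 0.
    by apply: contraNneq v0 => v0; rewrite -(trmxCK v) v0 trmx0 map_mx0.
  have := Hpos _ v0'; rewrite trmxCK ltcE => /andP[_].
  by rewrite -[X in _ < X]/(qf H v) vE pmulr_lgt0 // ip_gt0.
have s0 : 0 < 1 + \sum_i (d i)^-1.
  by apply: ltr_pwDl => //; apply: sumr_ge0 => i _; rewrite invr_ge0 ltW.
exists (1 + \sum_i (d i)^-1)^-1; first by rewrite invr_gt0.
move=> u; rewrite wE qE mulr_sumr; apply: ler_sum => i _.
apply: ler_wpM2r => //; rewrite -[leRHS]invrK lef_pV2 ?posrE ?invr_gt0 //.
apply: ler_wpDl => //; rewrite (bigD1 i) //= lerDl.
by apply: sumr_ge0 => j _; rewrite invr_ge0 ltW.
Qed.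

Lemma bounded_below_unitmx X c : 0 < c -> (forall u, c * ip u u <= qf X u) ->
  X \in unitmx.
Proof.
move=> c0 Xc; rewrite -row_free_unit -kermx_eq0.
apply/rowV0P => u /sub_kermxP uX.
apply/eqP; apply: contraTT isT => u0.
have := Xc u; rewrite /qf uX ip0l; apply: contraLR => _.
by rewrite -ltNge mulr_gt0 // ip_gt0.
Qed.

Lemma coercive_unitmx X : coercive X -> X \in unitmx.
Proof. by case=> _ [c c0]; exact: bounded_below_unitmx. Qed.

Lemma coercive_qf_ge0 X u : coercive X -> 0 <= qf X u.
Proof.
by case=> _ [c c0 /(_ u)]; apply: le_trans; rewrite mulr_ge0 ?ip_ge0 // ltW.
Qed.

(** With [v = u X^-1], Cauchy-Schwarz gives [c |v|^2 <= ip (v X) v <= |u| |v|]; cancel [|v|]. *)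
Lemma spectral_norm_inv_le X c : 0 < c -> (forall u, c * ip u u <= qf X u) ->
  spectral_norm (invmx X) <= c^-1.
Proof.
move=> c0 Xc; have Xu := bounded_below_unitmx c0 Xc.
apply: (spectral_norm_nm_le n_gt0) => [|u]; first by rewrite invr_ge0 ltW.
rewrite mulrC ler_pdivlMr // mulrC; set v := u *m invmx X.
have -> : u = v *m X by rewrite mulmxKV.
have := le_trans (Xc v) (ip_le_nm _ _); rewrite -nm_sqr.
have [<- _|h] := eqVneq 0 (nm v); first by rewrite mulr0 nm_ge0.
by rewrite expr2 mulrA ler_pM2r // lt_neqAle h nm_ge0.
Qed.

Lemma inv_herm X : X^t* = X -> (invmx X)^t* = invmx X.
Proof. by rewrite trmxC_inv => ->. Qed.

(* Expand [0 <= qf X (u X^-1 - r^-1 u Y^-1)]. *)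
Lemma qf_inv_antimono X Y r u : coercive X -> coercive Y -> 0 < r ->
  (forall v, qf X v <= r * qf Y v) -> qf (invmx Y) u <= r * qf (invmx X) u.
Proof.
move=> Xc Yc r0 XY.
have Xu := coercive_unitmx Xc; have Yu := coercive_unitmx Yc.
set a := u *m invmx X; set b := u *m invmx Y.
have aX : a *m X = u by rewrite mulmxKV.
have bY : b *m Y = u by rewrite mulmxKV.
have bXa : ip (b *m X) a = ip u b by rewrite ip_adj (proj1 Xc) aX ipC.
have := coercive_qf_ge0 (a - ((r^-1)%:C)%C *: b) Xc; have := XY b.
rewrite /qf mulmxBl -scalemxAl aX bY !ipDl !ipDr !ipNl !ipNr !ipZl !ipZr bXa.
rewrite -/a -/b (ipC a) (ipC b).
(* Here [x] and [y] are the forms of [X^-1] and [Y^-1] at [u], and [z = qf X b]. The expansion reads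
   [0 <= x - 2 y / r + z / r^2], and [z <= r y] turns it into [y / r <= x]. *)
move: (ip u a) (ip u b) (ip (b *m X) b) => x y z le_z.
have r'0 : 0 < r^-1 by rewrite invr_gt0.
have := ler_wpM2l (ltW r'0) le_z; rewrite mulKf ?gt_eqF // => {}le_z ge0.
have {}ge0 : r^-1 * y <= x.
  by have := ler_wpM2l (ltW r'0) le_z; lra.
by rewrite -ler_pdivrMl.
Qed.

End Coercive.

(** * Two facts about real numbers *)

Section Scalars.
Variable R : realType.

(** Write [f x = l + p x / (L x + P)], so [f b = b]. If [c < b], then [f c] is at least the value at
    [c] of the line [l + p x / (L b + P)]. This line joins [(0, l)] to [(b, b)], so it is strictly
    above the diagonal at [c], against [f c <= c]. *)
Lemma fixpoint_le (l p L P b c : R) : 0 < l -> 0 <= p -> 0 < L -> 0 <= P ->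
  0 < b -> 0 < c -> b = l + p / (L + P / b) -> l + p / (L + P / c) <= c ->
  b <= c.
Proof.
move=> l0 p0 L0 P0 b0 c0.
have fE x : 0 < x -> p / (L + P / x) = p * x / (L * x + P).
  move=> x0; have y0 : 0 < L * x + P by rewrite ltr_pwDl ?mulr_gt0.
  have z0 : 0 < L + P / x by rewrite ltr_pwDl // divr_ge0 // ltW.
  by field; rewrite !gt_eqF.
rewrite !fE // => bE cE; rewrite leNgt; apply/negP => cb.
have y0 : 0 < L * c + P by rewrite ltr_pwDl ?mulr_gt0.
have z0 : 0 < L * b + P by rewrite ltr_pwDl ?mulr_gt0.
have yz : L * c + P <= L * b + P by rewrite lerD2r ler_pM2l // ltW.
have h : l + p * c / (L * b + P) <= c.
  apply: le_trans cE; rewrite lerD2l; apply: ler_wpM2l.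
    by rewrite mulr_ge0 // ltW.
  by rewrite lef_pV2 ?posrE.
move: bE h; set z := L * b + P => bE h.
have bz : b * z = l * z + p * b by rewrite {1}bE; field; rewrite gt_eqF.
have cz : l * z + p * c <= c * z.
  by rewrite -ler_pdivrMr // mulrDl mulfK ?gt_eqF.
have lz : 0 < l * z by rewrite mulr_gt0.
have zp : 0 < z - p by rewrite -(pmulr_rgt0 _ b0); lra.
have : c * (z - p) < b * (z - p) by rewrite ltr_pM2r.
by lra.
Qed.

(** Bernoulli's inequality in the form [(1 - e)^k (1 + k e) <= 1], with [k] chosen by the
    Archimedean property so that [k e r > 1 + K]. *)
Lemma geometric_small (e r K : R) : 0 < e <= 1 -> 0 < r -> 0 <= K ->
  exists k, (1 - e) ^+ k * K < r.
Proof.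
move=> /andP[e0 e1] r0 K0.
have bern k : (1 - e) ^+ k * (1 + k%:R * e) <= 1.
  elim: k => [|k IH]; first by rewrite expr0; lra.
  rewrite exprS -natr1; apply: le_trans IH.
  have : 0 <= (1 - e) ^+ k by rewrite exprn_ge0 // subr_ge0.
  have : 0 <= k%:R :> R by [].
  move: ((1 - e) ^+ k) (k%:R : R) => x y y0 x0.
  have : 0 <= x * (e * e * (y + 1)) by rewrite !mulr_ge0 ?addr_ge0 // ltW.
  by nra.
have er0 : 0 < e * r by rewrite mulr_gt0.
have := archi_boundP (ltW (divr_gt0 (ltr_pwDl ltr01 K0) er0)).
set k := Num.bound _ => hk; exists k.
have {}hk : 1 + K < k%:R * (e * r) by rewrite -ltr_pdivrMr.
have := bern k; have : 0 <= (1 - e) ^+ k by rewrite exprn_ge0 // subr_ge0.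
move: ((1 - e) ^+ k) (k%:R : R) hk => x y h x0 hx.
have : x * (1 + K) <= x * (y * (e * r)) by rewrite ler_wpM2l // ltW.
have : x * (1 + y * e) * r <= r by rewrite ler_piMl // ltW.
have [->|xn] := eqVneq x 0; first by move=> *; rewrite mul0r.
have : 0 < x by rewrite lt_neqAle eq_sym xn.
by nra.
Qed.
End Scalars.

(* Conversion between norms of different matrices unfolds [sup] and hangs. *)
Local Opaque spectral_norm lambda_max lambda_min.

(** * The fixed-point map: lower bound, perturbation and contraction *)

Section FixedPointMap.
Variables (R : realType) (m n : nat).
Hypothesis n_gt0 : (0 < n)%N.
Implicit Types (u v : 'rV[R[i]]_n) (Q X Y Z : 'M[R[i]]_n) (c r : R).
Implicit Types (A B : 'I_m -> 'M[R[i]]_n).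

Definition fmap A Q X := Q + \sum_(i < m) (A i)^t* *m invmx X *m A i.

Lemma solves_equationE A Q X : solves_equation A Q X <-> X = fmap A Q X.
Proof.
rewrite /solves_equation /fmap; split=> [<-|{1}->]; last by rewrite addrK.
by rewrite subrK.
Qed.

Lemma coercive_inv_qf_ge0 X u : coercive X -> 0 <= qf (invmx X) u.
Proof.
move=> Xc; have Xu := coercive_unitmx Xc.
have := coercive_qf_ge0 (u *m invmx X) Xc.
by rewrite /qf mulmxKV // ipC.
Qed.

Lemma qf_fmap A Q X u :
  qf (fmap A Q X) u = qf Q u + \sum_(i < m) qf (invmx X) (u *m (A i)^t*).
Proof.
by rewrite qfD qf_sum; congr (_ + _); apply: eq_bigr => i _; rewrite qf_conj.
Qed.

Lemma coercive_fmap A Q X : coercive Q -> coercive X -> coercive (fmap A Q X).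
Proof.
move=> [Qh [c c0 Qc]] Xc; split.
  rewrite /fmap trmxCD Qh trmxC_sum; congr (_ + _).
  by apply: eq_bigr => i _; rewrite !trmxCM trmxCK inv_herm ?mulmxA; case: Xc.
exists c => // u; rewrite qf_fmap; apply: (le_trans (Qc u)); rewrite lerDl.
by apply: sumr_ge0 => i _; exact: coercive_inv_qf_ge0.
Qed.

(** Extreme eigenvalues of both sides of [X = fmap A Q X] give [upper] and [lower]. Inserting the
    first into the second shows that [lambda_min X] is at least the right side of the equation for
    [b], evaluated at [lambda_min X]; [fixpoint_le] then yields [b <= lambda_min X]. *)
Lemma solution_ge A Q X b : coercive Q -> coercive X -> X = fmap A Q X ->
  0 < b ->
  b = lambda_min Q + (\sum_(i < m) lambda_min ((A i)^t* *m A i)) /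
      (lambda_max Q + (\sum_(i < m) lambda_max ((A i)^t* *m A i)) / b) ->
  forall u, b * ip u u <= qf X u.
Proof.
move=> Qc Xc XE b0 bE.
have [[Qh [q q0 leQ]] [Xh [x x0 leX]]] := (Qc, Xc).
set p := \sum_(i < m) _ in bE; set P := \sum_(i < m) _ in bE.
have Ah i := gram_herm (A i).
have Q_gt0 : 0 < lambda_min Q.
  by apply: lt_le_trans q0 _; exact: lambda_min_ge.
have X_gt0 : 0 < lambda_min X.
  by apply: lt_le_trans x0 _; exact: lambda_min_ge.
have Qm_gt0 : 0 < lambda_max Q.
  by apply: lt_le_trans Q_gt0 _; exact: lambda_min_le_max.
have Xm_gt0 : 0 < lambda_max X.
  by apply: lt_le_trans X_gt0 _; exact: lambda_min_le_max.
have p_ge0 : 0 <= p by apply: sumr_ge0 => i _; exact: lambda_min_gram_ge0.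
have P_ge0 : 0 <= P.
  apply: sumr_ge0 => i _; apply: le_trans (lambda_min_gram_ge0 n_gt0 (A i)) _.
  exact: lambda_min_le_max.
have inv_le u : qf (invmx X) u <= (lambda_min X)^-1 * ip u u.
  apply: le_trans (qf_le_spectral_norm n_gt0 _ _) _.
  apply: ler_wpM2r; first exact: ip_ge0.
  by apply: (spectral_norm_inv_le n_gt0) => // v; exact: lambda_min_le_qf.
(* Antitonicity of inversion, comparing [X] with the identity. *)
have inv_ge u : (lambda_max X)^-1 * ip u u <= qf (invmx X) u.
  have one_c : coercive (1%:M : 'M[R[i]]_n).
    split; first by rewrite trmx1 map_mx1.
    by exists 1 => // v; rewrite mul1r /qf mulmx1.
  rewrite ler_pdivrMl //.
  have /= := @qf_inv_antimono _ _ _ _ _ u Xc one_c Xm_gt0.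
  rewrite invmx1 /qf mulmx1; apply=> v; rewrite mulmx1.
  exact: qf_le_lambda_max.
have upper : lambda_max X <= lambda_max Q + P / lambda_min X.
  apply: lambda_max_le => // u; rewrite {1}XE qf_fmap mulrDl.
  apply: lerD; first exact: qf_le_lambda_max.
  rewrite -mulrA mulr_suml; apply: ler_sum => i _.
  apply: le_trans (inv_le _) _; rewrite -qf_gram mulrCA.
  apply: ler_wpM2l; first by rewrite invr_ge0 ltW.
  exact: qf_le_lambda_max.
have lower : lambda_min Q + p / lambda_max X <= lambda_min X.
  apply: lambda_min_ge => // u; rewrite XE qf_fmap -XE mulrDl.
  apply: lerD; first exact: lambda_min_le_qf.
  rewrite -mulrA mulr_suml; apply: ler_sum => i _.
  apply: le_trans (inv_ge _); rewrite -qf_gram mulrCA.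
  apply: ler_wpM2l; first by rewrite invr_ge0 ltW.
  exact: lambda_min_le_qf.
move=> u; apply: le_trans (lambda_min_le_qf _ Xh).
apply: ler_wpM2r; first exact: ip_ge0.
apply: (fixpoint_le Q_gt0 p_ge0 Qm_gt0 P_ge0 b0 X_gt0 bE).
apply: le_trans lower; rewrite lerD2l; apply: ler_wpM2l => //.
move: (lambda_max Q) (lambda_min X) (lambda_max X) Qm_gt0 X_gt0 Xm_gt0 upper.
move=> L c d L_gt0 c_gt0 d_gt0 upper.
by rewrite lef_pV2 ?posrE // ltr_pwDl // divr_ge0 // ltW.
Qed.

Lemma mulmx_expand (K L G M N : 'M[R[i]]_n) :
  (K + L) *m G *m (M + N) =
  K *m G *m M + (L *m G *m M + K *m G *m N + L *m G *m N).
Proof.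
rewrite mulmxDl mulmxDl.
rewrite !(mulmxDr _ M N).
rewrite -[LHS]addrA.
congr (_ + _).
rewrite -[RHS]addrA.
exact: addrCA.
Qed.

(** With [E = B i - A i], the three terms of [B_i^* Z^-1 B_i] containing [E] give the part with
    factor [z]. What remains is [A_i^* (Z^-1 - X^-1) A_i], where [Z^-1 - X^-1 = - Z^-1 (Z - X) X^-1]
    has norm at most [z d x]. *)
Lemma fmap_sub_norm A B Q Q' X Z (x z d : R) :
  X \in unitmx -> Z \in unitmx ->
  spectral_norm (invmx X) <= x -> spectral_norm (invmx Z) <= z ->
  spectral_norm (Z - X) <= d ->
  spectral_norm (fmap B Q' Z - fmap A Q X) <=
  spectral_norm (Q' - Q) + z * (\sum_(i < m) spectral_norm (B i - A i) *
             (2 * spectral_norm (A i) + spectral_norm (B i - A i)))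
  + (\sum_(i < m) spectral_norm (A i) ^+ 2) * (z * d * x).
Proof.
move=> Xu Zu Xx Zz ZXd.
have x0 : 0 <= x := le_trans (spectral_norm_ge0 _) Xx.
have z0 : 0 <= z := le_trans (spectral_norm_ge0 _) Zz.
have d0 : 0 <= d := le_trans (spectral_norm_ge0 _) ZXd.
have -> : fmap B Q' Z - fmap A Q X = (Q' - Q) +
    \sum_(i < m) ((B i)^t* *m invmx Z *m B i - (A i)^t* *m invmx X *m A i).
  by rewrite sumrB /fmap opprD addrACA.
rewrite mulr_sumr mulr_suml -[leRHS]addrA -big_split /=.
apply: le_trans (spectral_normD n_gt0 _ _) _; rewrite lerD2l.
apply: le_trans (spectral_norm_sum n_gt0 _ _) _; apply: ler_sum => i _.
have : B i = A i + (B i - A i) by rewrite addrC subrK.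
move: (B i - A i) => E ->.
have GK : invmx Z - invmx X = - (invmx Z *m (Z - X) *m invmx X).
  by rewrite mulmxBr mulVmx // mulmxBl mul1mx opprB -mulmxA mulmxV // mulmx1.
have GKi : (A i)^t* *m invmx Z *m A i - (A i)^t* *m invmx X *m A i =
    - ((A i)^t* *m (invmx Z *m (Z - X) *m invmx X) *m A i).
  by rewrite -mulmxBl -mulmxBr GK mulmxN mulNmx.
have -> : (A i + E)^t* *m invmx Z *m (A i + E) - (A i)^t* *m invmx X *m A i =
   (E^t* *m invmx Z *m A i + (A i)^t* *m invmx Z *m E + E^t* *m invmx Z *m E)
   + - ((A i)^t* *m (invmx Z *m (Z - X) *m invmx X) *m A i).
  rewrite -GKi trmxCD mulmx_expand -[LHS]addrA.
  exact: addrCA.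
have nM3 (M N K : 'M[R[i]]_n) (y : R) : spectral_norm N <= y ->
    spectral_norm (M^t* *m N *m K) <= spectral_norm M * y * spectral_norm K.
  move=> Ny; apply: le_trans (spectral_normM n_gt0 _ _) _.
  apply: ler_wpM2r; first exact: spectral_norm_ge0.
  apply: le_trans (spectral_normM n_gt0 _ _) _.
  rewrite spectral_norm_adj //.
  by apply: ler_wpM2l => //; exact: spectral_norm_ge0.
have GZK : spectral_norm (invmx Z *m (Z - X) *m invmx X) <= z * d * x.
  apply: le_trans (spectral_normM n_gt0 _ _) _.
  apply: ler_pM => //; try exact: spectral_norm_ge0.
  apply: le_trans (spectral_normM n_gt0 _ _) _.
  by apply: ler_pM => //; exact: spectral_norm_ge0.
apply: le_trans (spectral_normD n_gt0 _ _) _; rewrite spectral_normN.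
apply: lerD; last first.
  by apply: le_trans (nM3 _ _ _ _ GZK) _; rewrite expr2 mulrAC.
apply: le_trans (spectral_normD n_gt0 _ _) _.
apply: le_trans (lerD (spectral_normD n_gt0 _ _) (lexx _)) _.
apply: le_trans
  (lerD (lerD (nM3 _ _ _ _ Zz) (nM3 _ _ _ _ Zz)) (nM3 _ _ _ _ Zz)) _.
move: (spectral_norm E) (spectral_norm (A i)) => e a.
by rewrite le_eqVlt; apply/orP; left; apply/eqP; ring.
Qed.

(** For coercive [X], [Z] and [v >= 1]: distance at most [log v] in Thompson's metric on the
    positive cone. *)
Definition pinched X (v : R) Z : Prop :=
  forall u, qf X u <= v * qf Z u /\ qf Z u <= v * qf X u.

(** Inversion preserves the factor [v], so the sum in [fmap A Q Z] is within factor [v] of the one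
    in [X]. The term [Q] is common to both and makes up at least the share [e] of [X], which lowers
    the factor. *)
Lemma fmap_pinched A Q X Z (e v : R) :
  coercive Q -> coercive X -> X = fmap A Q X -> coercive Z ->
  0 <= e <= 1 -> (forall u, e * qf X u <= qf Q u) ->
  1 <= v -> pinched X v Z -> pinched X (v - e * (v - 1)) (fmap A Q Z).
Proof.
move=> Qc Xc XE Zc /andP[e0 e1] eXQ v1 XZ.
have v0 : 0 < v by lra.
have ZX u : qf (invmx X) u <= v * qf (invmx Z) u.
  by apply: qf_inv_antimono => // w; have [] := XZ w.
have XZ' u : qf (invmx Z) u <= v * qf (invmx X) u.
  by apply: qf_inv_antimono => // w; have [] := XZ w.
move=> u; rewrite !qf_fmap.
have eQ := eXQ u.
have XuE : qf X u = qf Q u + \sum_(i < m) qf (invmx X) (u *m (A i)^t*).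
  by rewrite {1}XE qf_fmap.
set s := \sum_(i < m) _ in XuE; set t := \sum_(i < m) _.
have sle : s <= v * t by rewrite mulr_sumr; apply: ler_sum => i _.
have sge : t <= v * s by rewrite mulr_sumr; apply: ler_sum => i _.
move: XuE eQ sle sge (coercive_qf_ge0 u Xc).
move: (qf X u) (qf Q u) s t => x q s t -> eQ sle sge X0.
have vq : (v - 1) * (e * (q + s)) <= (v - 1) * q.
  by rewrite ler_wpM2l ?subr_ge0.
split; last by nra.
(* After multiplication by [v] the claim is [v (q + s) <= w v (q + t)]. Here [v (q + t) >= v q + s
   >= (1 + e (v - 1)) (q + s)], and [w (1 + e (v - 1)) - v = e (1 - e) (v - 1)^2]. *)
set w := v - e * (v - 1).
have w0 : 0 <= w by rewrite /w; nra.
rewrite -(ler_pM2l v0).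
apply: (@le_trans _ _ (w * (v * q + s))); last first.
  by rewrite mulrCA; apply: ler_wpM2l => //; rewrite mulrDr lerD2l.
apply: (@le_trans _ _ (w * ((1 + e * (v - 1)) * (q + s)))); last first.
  by apply: ler_wpM2l => //; lra.
rewrite mulrA; apply: ler_wpM2r => //.
have : 0 <= e * (1 - e) * (v - 1) ^+ 2.
  by rewrite !mulr_ge0 ?exprn_even_ge0 // subr_ge0.
by rewrite /w; lra.
Qed.

End FixedPointMap.

(** * Convergence of the iterates and distance to the fixed point *)

Section Perturbation.
Variables (R : realType) (m n : nat).
Hypothesis n_gt0 : (0 < n)%N.
Implicit Types (Q X Y Z : 'M[R[i]]_n) (A B : 'I_m -> 'M[R[i]]_n).

Lemma qf_bounded X : exists2 a : R, 0 <= a & forall u, qf X u <= a * ip u u.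
Proof.
exists (spectral_norm X); first exact: spectral_norm_ge0.
by move=> u; exact: qf_le_spectral_norm.
Qed.

Lemma coercive_iter_fmap A Q Y k : coercive Q -> coercive Y ->
  coercive (iter k (fmap A Q) Y).
Proof.
move=> Qc Yc; elim: k => [|k IH]; first exact: Yc.
by rewrite iterS; exact: (coercive_fmap A Qc IH).
Qed.

Lemma iter_fmap_pinched A Q X Y : coercive Q -> coercive X ->
  X = fmap A Q X -> coercive Y ->
  exists e K : R, [/\ 0 < e <= 1, 0 <= K &
    forall k, pinched X (1 + (1 - e) ^+ k * K) (iter k (fmap A Q) Y)].
Proof.
move=> Qc Xc XE Yc.
have [[_ [q q0 leQ]] [_ [x x0 leX]] [_ [y y0 leY]]] := And3 Qc Xc Yc.
have [a a0 Xle] := qf_bounded X; have [c c0 Yle] := qf_bounded Y.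
have qa : 0 < q + a by rewrite ltr_pwDl.
(* From [q <= Q] and [X <= a] follows [e X <= Q]; the denominator [q + a] also keeps [e] at most 1.
   [K] exceeds both ratios [a / y] and [c / x] that compare [X] with [Y] at the start. *)
pose e := q / (q + a); pose K := a / y + c / x.
have e0 : 0 < e by rewrite divr_gt0.
have e1 : e <= 1 by rewrite ler_pdivrMr // mul1r lerDl.
have K0 : 0 <= K by rewrite addr_ge0 // divr_ge0 // ltW.
exists e, K; split=> //; first by rewrite e0 e1.
have eXQ u : e * qf X u <= qf Q u.
  apply: le_trans (leQ u); apply: le_trans (ler_wpM2l (ltW e0) (Xle u)) _.
  rewrite mulrA; apply: ler_wpM2r; first exact: ip_ge0.
  by rewrite mulrAC ler_pdivrMr // ler_wpM2l ?(ltW q0) // lerDr ltW.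
elim=> [|k IH] /=.
  have start Z Z' (z b : R) u : 0 < z -> 0 <= b ->
      (forall u, z * ip u u <= qf Z u) -> (forall u, qf Z' u <= b * ip u u) ->
      b / z <= K -> qf Z' u <= (1 + 1 * K) * qf Z u.
    move=> z0 b0 Zz Zb zK; have Z0 : 0 <= qf Z u.
      by apply: le_trans (Zz u); rewrite mulr_ge0 ?ip_ge0 // ltW.
    apply: le_trans (Zb u) _; apply: (@le_trans _ _ (b / z * qf Z u)).
      by rewrite -mulrA; apply: ler_wpM2l => //; rewrite ler_pdivlMl.
    by apply: ler_wpM2r => //; rewrite mul1r ler_wpDl.
  move=> u; rewrite expr0; split.
    by apply: (start _ _ y a) => //; rewrite lerDl divr_ge0 // ltW.
  by apply: (start _ _ x c) => //; rewrite lerDr divr_ge0 // ltW.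
have Zc := coercive_iter_fmap A k Qc Yc.
have := fmap_pinched Qc Xc XE Zc _ eXQ _ IH.
rewrite (ltW e0) e1 lerDl mulr_ge0 ?exprn_ge0 ?subr_ge0 // => /(_ isT isT).
by rewrite exprS (_ : _ - _ = 1 + (1 - e) * (1 - e) ^+ k * K) //; ring.
Qed.

(** On forms, [Z - X <= (v - 1) X] is immediate. Conversely [X - Z <= (v - 1) Z], which is at most
    [(v - 1) X] at vectors where [Z] is below [X]; elsewhere [X - Z] is negative. *)
Lemma pinched_sub_norm X Z (v : R) : coercive X -> coercive Z -> 1 <= v ->
  pinched X v Z -> spectral_norm (X - Z) <= (v - 1) * spectral_norm X.
Proof.
move=> Xc Zc v1 XZ; have v10 : 0 <= v - 1 by rewrite subr_ge0.
have bound u : (v - 1) * qf X u <= (v - 1) * spectral_norm X * ip u u.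
  by rewrite -mulrA ler_wpM2l // qf_le_spectral_norm.
apply: spectral_norm_herm_le => // [||u|u].
- by rewrite trmxCD trmxCN (proj1 Xc) (proj1 Zc).
- by rewrite mulr_ge0 ?spectral_norm_ge0.
- apply: le_trans (bound u); rewrite qfD qfN.
  have [] := XZ u; have := coercive_qf_ge0 u Xc; have := coercive_qf_ge0 u Zc.
  move: (qf X u) (qf Z u) => x z; have [zx|xz] := leP z x; last by nra.
  by nra.
- have [_] := XZ u; rewrite qfD qfN lerNl opprB => h.
  apply: le_trans (bound u); move: (qf X u) (qf Z u) h => x z.
  by lra.
Qed.

(** No limit is taken: for each [r > 0] some iterate started at [Y] is within [r] of [X], and it is
    still within [d] of [Y], so the distance is at most [d + r]. *)
Lemma fixed_point_dist A Q X Y (d : R) : coercive Q -> coercive X ->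
  X = fmap A Q X -> coercive Y ->
  (forall Z, coercive Z -> spectral_norm (Z - Y) <= d ->
     spectral_norm (fmap A Q Z - Y) <= d) ->
  0 <= d -> spectral_norm (X - Y) <= d.
Proof.
move=> Qc Xc XE Yc stable d0.
have [e [K [e01 K0 pinch]]] := iter_fmap_pinched Qc Xc XE Yc.
have [_ e1] := andP e01.
have dist k : spectral_norm (iter k (fmap A Q) Y - Y) <= d.
  elim: k => [|k IH].
    apply: spectral_norm_le => // u v.
    by rewrite subrr mulmx0 ip0l mulr_ge0 // mulr_ge0 // nm_ge0.
  by rewrite iterS; exact: (stable _ (coercive_iter_fmap A k Qc Yc) IH).
apply/ler_addgt0Pr => r r0.
have [k kr] := geometric_small e01 r0 (mulr_ge0 K0 (spectral_norm_ge0 X)).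
move: (iter k _ Y) (coercive_iter_fmap A k Qc Yc) (dist k) (pinch k).
move=> Z Zc Zd XZ; have -> : X - Y = (Z - Y) + (X - Z).
  by rewrite [RHS]addrC [RHS]addrA subrK.
apply: le_trans (spectral_normD n_gt0 _ _) _; apply: (lerD Zd).
apply: le_trans (ltW kr); rewrite mulrA.
have := pinched_sub_norm Xc Zc _ XZ; rewrite lerDl.
rewrite mulr_ge0 ?exprn_ge0 ?subr_ge0 // => /(_ isT).
by rewrite addrAC subrr add0r.
Qed.

Lemma coercive_norm_ge X (c : R) :
  (forall u, c * ip u u <= qf X u) -> c <= spectral_norm X.
Proof.
move=> Xc; pose u : 'rV[R[i]]_n := const_mx 1.
have u0 : u != 0.
  apply/eqP => /rowP/(_ (Ordinal n_gt0))/eqP; by rewrite !mxE oner_eq0.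
rewrite -(ler_pM2r (ip_gt0 u0)).
exact: le_trans (Xc u) (qf_le_spectral_norm n_gt0 _ _).
Qed.

End Perturbation.

(* The last clause, cleared of denominators, is the quadratic equation
   [beta d^2 - b d + beta (beta q + s) = 0], of which [d] is the smaller root. *)
Lemma smaller_root (R : rcfType) (beta b q s a D d : R) :
  0 < beta -> 0 <= q -> 0 <= s -> b = beta ^+ 2 + beta * q - a ->
  0 < b -> b < 2 * beta ^+ 2 ->
  D = b ^+ 2 - 4 * beta ^+ 2 * (beta * q + s) -> 0 <= D ->
  d = 2 * beta * (s + beta * q) / (b + Num.sqrt D) ->
  [/\ 0 <= d, d < beta &
      q + (beta - d)^-1 * s + a * ((beta - d)^-1 * d * beta^-1) = d].
Proof.
move=> beta0 q0 s0 bE b0 b2 DE D0.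
have r0 := sqrtr_ge0 D; have rE := sqr_sqrtr D0.
move: (Num.sqrt D) r0 rE => r r0 rE def_d.
have br : 0 < b + r by lra.
(* Rationalise: [(b - r) (b + r) = b^2 - D = 4 beta^2 (beta q + s)]. *)
have dE : 2 * beta * d = b - r.
  rewrite def_d mulrA; apply: (canLR (mulfK _)); first by rewrite gt_eqF.
  by rewrite -subr_sqr rE DE; ring.
have d0 : 0 <= d.
  by rewrite def_d divr_ge0 ?(ltW br) // !mulr_ge0 ?addr_ge0 ?mulr_ge0 // ltW.
(* By [dE], [2 beta d <= b < 2 beta^2]. *)
have db : d < beta.
  by rewrite -(ltr_pM2l (mulr_gt0 (ltr0n R 2) beta0)) dE; lra.
split=> //.
have bd : beta - d != 0 by rewrite subr_eq0 gt_eqF.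
have root : beta * d ^+ 2 - b * d + beta * (beta * q + s) = 0.
  have h : (2 * beta * d - b) ^+ 2 = D by rewrite dE -rE; ring.
  apply: (mulfI (_ : 4 * beta != 0)); first by rewrite mulf_neq0 ?gt_eqF.
  rewrite mulr0; apply: (@eq_trans _ _ ((2 * beta * d - b) ^+ 2 - D)).
    by rewrite DE; ring.
  by rewrite h subrr.
apply/eqP; rewrite -subr_eq0; apply/eqP.
(* Over the common denominator [beta (beta - d)] the numerator is the quadratic; this is where the
   definition of [b] enters. *)
rewrite (_ : _ - d = (beta * d ^+ 2 - b * d + beta * (beta * q + s))
                     / (beta * (beta - d))); first by rewrite root mul0r.
by rewrite bE; field; rewrite bd gt_eqF.
Qed.

(** * The relative perturbation bound *)

Theorem theorem4p1 (R : realType) (m n : nat)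
    (m_gt0 : (0 < m)%N) (n_gt0 : (0 < n)%N)
    (A A' : 'I_m -> 'M[R[i]]_n) (Q Q' X X' : 'M[R[i]]_n)
    (Q_pd : hermitian_posdef Q) (Q'_pd : hermitian_posdef Q')
    (X_pd : hermitian_posdef X) (X_sol : solves_equation A Q X)
    (X'_pd : hermitian_posdef X') (X'_sol : solves_equation A' Q' X')
    (beta : R) (beta_gt0 : 0 < beta)
    (beta_sol : beta =
       lambda_min Q +
       (\sum_(i < m) lambda_min ((A i)^t* *m A i)) /
       (lambda_max Q + (\sum_(i < m) lambda_max ((A i)^t* *m A i)) / beta)) :
  let dA := fun i : 'I_m => A' i - A i in
  let dQ := Q' - Q in
  let b := beta ^+ 2 + beta * spectral_norm dQ
           - \sum_(i < m) spectral_norm (A i) ^+ 2 in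
  let s := \sum_(i < m) spectral_norm (dA i) *
             (2 * spectral_norm (A i) + spectral_norm (dA i)) in
  let D := b ^+ 2 - 4 * beta ^+ 2 * (beta * spectral_norm dQ + s) in
  let rho := 2 * s / ((\sum_(i < m) spectral_norm (dA i)) * (b + Num.sqrt D)) in
  let omega := 2 * beta / (b + Num.sqrt D) in
  0 < b -> b < 2 * beta ^+ 2 -> 0 <= D ->
  spectral_norm (X' - X) / spectral_norm X <=
    rho * (\sum_(i < m) spectral_norm (dA i)) + omega * spectral_norm dQ.
Proof.
move=> dA dQ b s D rho omega b_gt0 b_lt D_ge0.
have [Qc Q'c] := (posdef_coercive Q_pd, posdef_coercive Q'_pd).
have [Xc X'c] := (posdef_coercive X_pd, posdef_coercive X'_pd).
have XE : X = fmap A Q X by apply/solves_equationE.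
have X'E : X' = fmap A' Q' X' by apply/solves_equationE.
have X_ge := solution_ge n_gt0 Qc Xc XE beta_gt0 beta_sol.
have q_ge0 : 0 <= spectral_norm dQ by exact: spectral_norm_ge0.
have s_ge0 : 0 <= s.
  apply: sumr_ge0 => i _; apply: mulr_ge0; first exact: spectral_norm_ge0.
  by apply: addr_ge0; rewrite ?mulr_ge0 ?spectral_norm_ge0.
pose d := 2 * beta * (s + beta * spectral_norm dQ) / (b + Num.sqrt D).
have [d_ge0 d_lt d_fix] := smaller_root beta_gt0 q_ge0 s_ge0
  (erefl b) b_gt0 b_lt (erefl D) D_ge0 (erefl d).
have bd_gt0 : 0 < beta - d by rewrite subr_gt0.
have dist : spectral_norm (X' - X) <= d.
  apply: (fixed_point_dist n_gt0 Q'c X'c X'E Xc _ d_ge0) => Z Zc Zd.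
  (* Write [Z = (Z - X) + X], with [X >= beta] and [Z - X >= -d]. *)
  have Z_ge u : (beta - d) * ip u u <= qf Z u.
    rewrite -(subrK X Z) qfD mulrBl [leRHS]addrC; apply: (lerD (X_ge u)).
    apply: le_trans (qf_ge_spectral_norm n_gt0 (Z - X) u).
    by rewrite lerN2; apply: ler_wpM2r Zd; exact: ip_ge0.
  (* By [d_fix], [d] is exactly the bound of [fmap_sub_norm] for [x = beta^-1] and
     [z = (beta - d)^-1]. *)
  rewrite [in leLHS]XE -[leRHS]d_fix.
  apply: (fmap_sub_norm n_gt0 A A' Q Q' _ _ _ _ Zd).
  - exact: coercive_unitmx Xc.
  - exact: coercive_unitmx Zc.
  - exact: (spectral_norm_inv_le n_gt0 beta_gt0 X_ge).
  - exact: (spectral_norm_inv_le n_gt0 bd_gt0 Z_ge).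
have br_gt0 : 0 < b + Num.sqrt D by rewrite ltr_wpDr ?sqrtr_ge0.
have X_norm : beta <= spectral_norm X by exact: coercive_norm_ge.
have rhoE : rho * (\sum_(i < m) spectral_norm (dA i)) =
            2 * s / (b + Num.sqrt D).
  rewrite /rho; set t := \sum_(i < m) _; have [t0|t_neq0] := eqVneq t 0.
    (* If the norms of all [dA i] vanish, the left side is 0 whatever value [rho] takes, and [s] is
       0 as well. *)
    rewrite t0 mulr0 [s](_ : _ = 0) ?mulr0 ?mul0r //.
    apply: big1 => i _; move/eqP: t0.
    rewrite psumr_eq0 => [/allP/(_ i)|j _]; last exact: spectral_norm_ge0.
    by rewrite mem_index_enum => /(_ isT)/eqP ->; rewrite mul0r.
  by field; rewrite t_neq0 gt_eqF.
rewrite rhoE /omega ler_pdivrMr; last exact: lt_le_trans beta_gt0 X_norm.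
apply: (le_trans dist).
(* [d] is [beta] times the claimed relative bound, so [beta <= |X|] finishes the proof. *)
rewrite (_ : d = (2 * s / (b + Num.sqrt D) +
   2 * beta / (b + Num.sqrt D) * spectral_norm dQ) * beta); last first.
  by rewrite /d; field; rewrite gt_eqF.
apply: ler_wpM2l X_norm.
apply: addr_ge0; rewrite ?mulr_ge0 ?invr_ge0 //; exact: ltW.
Qed.
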